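(* There exists a smooth diffeomorphism $f:\mathbb{R}^2\to\mathbb{R}^2$ having an order four periodic point and such that $\infty$ is a repellor for $f$, $f(0)=0$ and $\operatorname{Spec}(f)\subset B(0,1)$.
   Context: $\operatorname{Spec}(f)\subset\mathbb{C}$ denotes the set of all eigenvalues of $Df_p$, taken over all $p\in\mathbb{R}^2$, and $B(0,1)$ is the open unit disc in $\mathbb{C}$. An order four periodic point is a point $p$ whose least period under $f$ is $4$. A diffeomorphism $f$ of $\mathbb{R}^2$ onto itself is extended to a homeomorphism of the Riemann sphere $\mathbb{R}^2\cup\{\infty\}$ by setting $f(\infty)=\infty$. The point $\infty$ is a repellor for $f$ if there exists a compact disc $D\subset\mathbb{R}^2\cup\{\infty\}$ which is a neighborhood of $\infty$ such that $f^{-1}(D)\subset\operatorname{Int}(D)$ and $\bigcap_{n=1}^\infty f^{-n}(D)=\{\infty\}$. *)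

(* Defs.v *)
From HB Require Import structures.
From mathcomp Require Import all_boot all_order all_algebra.
From mathcomp Require Import all_classical all_reals all_analysis.
From mathcomp.real_closed Require Import complex.

Set Implicit Arguments.
Unset Strict Implicit.
Unset Printing Implicit Defensive.

Import Order.TTheory GRing.Theory Num.Theory.
Import numFieldNormedType.Exports.

Local Open Scope classical_set_scope.
Local Open Scope ring_scope.

(* In finite dimension [D f] is of class C^k iff each of the maps
   [x |-> D f_x v] is, whence the recursion on directional derivatives. *)
Fixpoint class_C (R : realType) (m n k : nat)
    (f : 'rV[R]_m -> 'rV[R]_n) : Prop :=
  if k is k'.+1 then
    (forall x, differentiable f x) /\ forall v, class_C k' ('D_v f)
  else continuous f.

Definition smooth (R : realType) (m n : nat) (f : 'rV[R]_m -> 'rV[R]_n) :=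
  forall k, class_C k f.

Definition smooth_diffeomorphism (R : realType) (n : nat)
    (f : 'rV[R]_n -> 'rV[R]_n) :=
  smooth f /\ exists g, [/\ smooth g, cancel f g & cancel g f].

(* ['J f p] acts on row vectors on the right, ['d f p v = v *m 'J f p], and
   [eigenvalue] is about [v *m A = z *: v] with [v != 0]: these are the
   eigenvalues of the linear map [Df_p], the entries being read in [R[i]]. *)
Definition Spec (R : realType) (n : nat) (f : 'rV[R]_n -> 'rV[R]_n) : set R[i] :=
  [set z | exists p, eigenvalue (map_mx (real_complex R) ('J f p)) z].

Definition unit_disc (R : realType) : set R[i] := [set z | `|z| < 1].

Definition periodic_point (T : Type) (n : nat) (f : T -> T) (p : T) :=
  [/\ (0 < n)%N, iter n f p = p &
      forall k, (0 < k < n)%N -> iter k f p <> p].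

Definition homeomorphic (T U : topologicalType) (A : set T) (B : set U) :=
  exists (h : T -> U) (g : U -> T),
    [/\ {within A, continuous h}, {within B, continuous g},
        h @` A = B & {in A, cancel h g}].

(* The norm of ['rV[R]_2] is the sup norm; the disc is the Euclidean one. *)
Definition closed_unit_disc (R : realType) : set 'rV[R]_2 :=
  [set x | x 0 0 ^+ 2 + x 0 1 ^+ 2 <= 1].

(* The Riemann sphere is [one_point_compactification 'rV[R]_2], whose point at
   infinity is [None]. *)
Definition extend_infty (T : Type) (f : T -> T) :
    one_point_compactification T -> one_point_compactification T := omap f.

Definition infty_repellor (R : realType) (f : 'rV[R]_2 -> 'rV[R]_2) :=
  let F := extend_infty f in
  exists D : set (one_point_compactification 'rV[R]_2),
    [/\ homeomorphic (@closed_unit_disc R) D,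
        nbhs (None : one_point_compactification 'rV[R]_2) D,
        F @^-1` D `<=` interior D &
        \bigcap_(n in [set n | (1 <= n)%N]) (iter n F @^-1` D) = [set None]].

(* Main.v *)
Require Import Defs.
From mathcomp Require Import all_boot all_order all_algebra.
From mathcomp Require Import all_classical all_reals all_analysis.
From mathcomp.real_closed Require Import complex.
From mathcomp Require Import ring lra.

Set Implicit Arguments.
Unset Strict Implicit.

Import Order.TTheory GRing.Theory Num.Theory.
Import numFieldNormedType.Exports.

Local Open Scope classical_set_scope.
Local Open Scope ring_scope.

(** The map is the damped rotation [f(x, y) = (b y, a sin y - b x)] with
    [0 < b < 1]. Its derivative has determinant [b^2] and trace [a cos y], so
    both eigenvalues lie in the open unit disc as soon as [|a| < 1 + b^2]. The
    sine being bounded, [f] is a Euclidean contraction by [b] up to a bounded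
    error, so all orbits enter a fixed ball: infinity is a repellor.
    A period four orbit [(bt, 2t) -> (2bt, -t) -> (-bt, -2t) -> (-2bt, t)]
    exists as soon as [a sin t = 2 (1 - b^2) t] and
    [a sin 2t = - (1 - b^2) t], that is, for [sin t <> 0], [cos t = -1/4] and
    [a = 2 (1 - b^2) t / sin t]; the resulting [a] obeys the bound above when
    [b] is close to 1, for instance [b = 9/10]. *)

(** * Smoothness of affine maps perturbed by a sinusoid of one coordinate *)

Section Smoothness.
Context {R : realType} {m n : nat}.
Implicit Types (M : 'M[R]_(m, n)) (u w c : 'rV[R]_n) (x v : 'rV[R]_m).

Lemma is_diff_mulmxr M x : is_diff x (mulmxr M) (mulmxr M).
Proof.
have Mc : continuous (mulmxr M : 'rV[R]_m -> 'rV[R]_n).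
  move=> y; apply: differentiable_continuous.
  rewrite (_ : mulmxr M = \sum_(i < m) (fun z : 'rV_m => z 0 i *: row i M)).
    apply: differentiable_sum => i.
    exact/differentiableZl/differentiable_coord.
  by apply/funext => z; rewrite fct_sumE /= mulmx_sum_row.
by split; [exact: linear_differentiable|rewrite diff_lin].
Qed.

Lemma is_diff_coord_fun (g : R -> R) (dg : R) u j x :
  is_derive (x 0 j) 1 g dg ->
  is_diff x (fun y => g (y 0 j) *: u) (fun v => (v 0 j * dg) *: u).
Proof.
move=> gP.
have gdiff : differentiable g (x 0 j) by apply/derivable1_diffP.
have cdiff : differentiable (fun y : 'rV[R]_m => y 0 j : R) x.
  exact: differentiable_coord.
have gc : differentiable (g \o (fun y : 'rV[R]_m => y 0 j : R)) x.
  exact: differentiable_comp.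
have cE : 'd (fun y : 'rV[R]_m => y 0 j : R) x = (fun v => v 0 j) :> (_ -> _).
  (* The coordinate is packed as a linear map so that [diff_lin] identifies it with its own
     differential. *)
  have @f : {linear 'rV[R]_m -> R}.
    by exists (fun N : 'rV[R]_m => N 0 j); do 2![eexists]; do ?[constructor];
      rewrite ?mxE// => ? *; rewrite ?mxE//; move=> ?; rewrite !mxE.
  by rewrite (_ : (fun _ => _) = f) // diff_lin //; exact: coord_continuous.
split; first exact: (differentiableZl _ gc).
have /= -> := diffZl u gc; apply/funext => v.
by rewrite diff_comp //= cE deriv1E //= derive1E derive_val.
Qed.

(** This family is closed under directional derivatives, with [o] and [j] unchanged, so a single
    induction on the order proves smoothness. It contains the damped rotation as well as its
    inverse. *)
Definition sinusoid c M (o : R) j u w x : 'rV[R]_n :=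
  c + x *m M + sin (o * x 0 j) *: u + cos (o * x 0 j) *: w.

Lemma is_diff_sinusoid c M o j u w x :
  is_diff x (sinusoid c M o j u w)
    (fun v => v *m M +
      (o * v 0 j) *: (cos (o * x 0 j) *: u - sin (o * x 0 j) *: w)).
Proof.
have oP : is_derive (x 0 j) 1 ( *%R o) (o *: 1) by exact: is_deriveZ.
have /= sP := is_diff_coord_fun u (is_derive1_comp (is_derive_sin _) oP).
have /= cP := is_diff_coord_fun w (is_derive1_comp (is_derive_cos _) oP).
have MP := is_diffD (is_diff_cst c x) (is_diff_mulmxr M x).
have := is_diffD (is_diffD MP sP) cP.
set F := (F in is_diff_def _ F _); have -> : F = sinusoid c M o j u w by [].
move=> H; apply: (is_diff_eq H); apply/funext => v.
rewrite !fctE /= add0r -addrA; congr (_ + _).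
rewrite scalerBr !scalerA -scaleNr; congr (_ *: _ + _ *: _); rewrite /GRing.scale /=; ring.
Qed.

Lemma derive_sinusoid c M o j u w v :
  'D_v (sinusoid c M o j u w) =
  sinusoid (v *m M) 0 o j (- (o * v 0 j) *: w) ((o * v 0 j) *: u).
Proof.
apply/funext => x; have xP := is_diff_sinusoid c M o j u w x.
rewrite deriveE// diff_val /sinusoid mulmx0 addr0.
rewrite scalerBr !scalerA -!addrA; congr (_ + _).
by rewrite addrC mulrN scaleNr (mulrC (sin _)) (mulrC (cos _)).
Qed.

Lemma smooth_sinusoid c M o j u w : smooth (sinusoid c M o j u w).
Proof.
move=> k; elim: k c M u w => [|k IH] c M u w /=.
  move=> x; apply: differentiable_continuous.
  by have := is_diff_sinusoid c M o j u w x.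
split => [x|v]; first by have := is_diff_sinusoid c M o j u w x.
by rewrite derive_sinusoid.
Qed.
End Smoothness.

(** A non-real root has real part [t / 2] and square modulus [d]. A real root [x] with [|x| >= 1]
    would give [x^2 + d = t x < (1 + d) |x|], that is [(|x| - 1) (|x| - d) < 0], which is absurd for
    [d < 1]. *)
Lemma schur_stable_quadratic (R : realType) (t d : R) (z : R[i]) :
  0 < d < 1 -> `|t| < 1 + d ->
  z ^+ 2 - t%:C%C * z + d%:C%C = 0 -> `|z| < 1.
Proof.
case: z => x y /andP[d0 d1] /ltr_normlP[t1 t2] /eqP.
rewrite expr2 normc_def; simpc => /= /eqP[re im].
have h : x ^+ 2 + y ^+ 2 < 1.
  have [y0|y0] := eqVneq y 0.
    have [x1|x1] := ltP x 1; last by nra.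
    have [x2|x2] := ltP (- 1) x; last by nra.
    by rewrite y0; nra.
  have tx : t = 2 * x by apply: (mulIf y0); lra.
  by rewrite tx in re; nra.
by rewrite -sqrtr1 ltr_sqrt.
Qed.

(** * Euclidean discs about infinity on the Riemann sphere *)

Section Compactification.
Context {R : realType}.
Implicit Types (p x : 'rV[R]_2) (r : R).

Definition sqnorm p : R := p 0 0 ^+ 2 + p 0 1 ^+ 2.

Lemma sqnorm_ge0 p : 0 <= sqnorm p.
Proof. by rewrite addr_ge0 ?sqr_ge0. Qed.

Lemma rV2_ext (T : Type) (p x : 'rV[T]_2) :
  p 0 0 = x 0 0 -> p 0 1 = x 0 1 -> p = x.
Proof.
move=> p0 p1; apply/rowP; case=> [[|[|//]] i2].
  by rewrite (_ : Ordinal i2 = 0) //; exact/val_inj.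
by rewrite (_ : Ordinal i2 = 1) //; exact/val_inj.
Qed.

Lemma sqr_coord_le p i : p 0 i ^+ 2 <= sqnorm p.
Proof.
case: i => [[|[|//]] i2].
  by rewrite (_ : Ordinal i2 = 0) ?lerDl ?sqr_ge0 //; exact/val_inj.
by rewrite (_ : Ordinal i2 = 1) ?lerDr ?sqr_ge0 //; exact/val_inj.
Qed.

Lemma sqnorm0 : sqnorm 0 = 0.
Proof. by rewrite /sqnorm !mxE expr0n addr0. Qed.

Lemma sqnorm_eq0 p : (sqnorm p == 0) = (p == 0).
Proof.
apply/idP/eqP => [|->]; last by rewrite sqnorm0.
rewrite paddr_eq0 ?sqr_ge0 // !sqrf_eq0 => /andP[/eqP p0 /eqP p1].
by apply: rV2_ext; rewrite mxE.
Qed.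

Lemma sqnorm_gt0 p : (0 < sqnorm p) = (p != 0).
Proof. by rewrite lt_def sqnorm_ge0 andbT sqnorm_eq0. Qed.

Lemma sqnormZ r p : sqnorm (r *: p) = r ^+ 2 * sqnorm p.
Proof. by rewrite /sqnorm !mxE; ring. Qed.

Lemma sqr_norm_le_sqnorm p : `|p| ^+ 2 <= sqnorm p.
Proof.
have -> : `|p| = mx_norm p by []; rewrite mx_normrE.
elim/big_ind: _ => [|a b ha hb|[i j] _ /=].
- by rewrite expr0n sqnorm_ge0.
- by rewrite /Order.max; case: ifP.
- by rewrite (ord1 i) real_normK ?num_real // sqr_coord_le.
Qed.

Lemma continuous_sqnorm : continuous sqnorm.
Proof.
have sqr_cts i : continuous (fun p : 'rV[R]_2 => p 0 i ^+ 2 : R).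
  move=> p; have ci : {for p, continuous (fun q : 'rV[R]_2 => q 0 i : R)}.
    exact: coord_continuous.
  exact: (cvgM ci ci).
by move=> p; exact: (cvgD (sqr_cts 0 p) (sqr_cts 1 p)).
Qed.

Lemma nbhs_sqnorm_gt r p : r < sqnorm p -> nbhs p [set x | r < sqnorm x].
Proof.
move=> rp; have : nbhs (sqnorm p) [set s | r < s] by exact: lt_nbhsr.
exact: continuous_sqnorm.
Qed.

Lemma compact_sqnorm_le r : compact [set p | sqnorm p <= r].
Proof.
apply: bounded_closed_compact.
  exists (r + 1); split; first exact: num_real.
  move=> M rM p /= pr.
  have := sqr_norm_le_sqnorm p; have := normr_ge0 p; have := sqnorm_ge0 p.
  nra.
apply: (closed_comp _ (@closed_le _ r)) => p _.
exact: continuous_sqnorm.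
Qed.

Lemma nbhs0_sqnormP (V : set 'rV[R]_2) :
  nbhs (0 : 'rV[R]_2) V <-> exists2 e, 0 < e & forall p, sqnorm p < e -> V p.
Proof.
split=> [/nbhs_ballP[e /= e0 eV]|[e e0 eV]].
  exists (e ^+ 2) => [|p pe]; first exact: exprn_gt0.
  apply: eV; rewrite -ball_normE /= sub0r normrN.
  have := sqr_norm_le_sqnorm p; have := normr_ge0 p; nra.
have e0' : nbhs (sqnorm 0) [set s | s < e] by rewrite sqnorm0; exact: lt_nbhsl.
have : nbhs (0 : 'rV[R]_2) [set p | sqnorm p < e].
  exact: continuous_sqnorm e0'.
by apply: filterS => p; exact: eV.
Qed.

Local Notation sphere := (one_point_compactification 'rV[R]_2).

(** Closed Euclidean discs are compact, and every compact set lies in one of them, so their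
    complements form a base at infinity. *)
Lemma nbhs_inftyP (U : set sphere) :
  nbhs (None : sphere) U <->
  U None /\ exists b, forall p, b < sqnorm p -> U (Some p).
Proof.
split=> [[C [cptC clC] CU]|[UN [b bU]]].
  split; first by apply: CU; right.
  have [M [_ /(_ (M + 1))]] : bounded_set (sqnorm @` C).
    apply: compact_bounded; apply: continuous_compact => //.
    exact/continuous_subspaceT/continuous_sqnorm.
  rewrite ltrDl ltr01 => /(_ isT) CM.
  exists (M + 1) => p Mp; apply: CU; left; exists p => // Cp.
  have /= := CM (sqnorm p) (ex_intro2 _ _ p Cp erefl).
  by rewrite ger0_norm ?sqnorm_ge0 // leNgt Mp.
exists [set p | sqnorm p <= b].
  split; first exact: compact_sqnorm_le.
  by apply: (closed_comp _ (@closed_le _ b)) => p _; exact: continuous_sqnorm.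
by move=> _ [[p /negP pb <-]|->//]; apply: bU; rewrite ltNge.
Qed.

(** For [r > 0], the inversion in the circle of square radius [r]: it exchanges the unit circle with
    the circle of radius [r]. Its value at 0 is the default 0. *)
Definition inversion r p : 'rV[R]_2 := (r / sqnorm p) *: p.

Lemma sqnorm_inversion r p : sqnorm (inversion r p) = r ^+ 2 / sqnorm p.
Proof.
rewrite sqnormZ; have [->|p0] := eqVneq (sqnorm p) 0; last by field.
by rewrite mulr0 invr0 mulr0.
Qed.

Lemma inversionK r p : r != 0 -> p != 0 -> inversion r (inversion r p) = p.
Proof.
rewrite -sqnorm_eq0 => r0 p0; rewrite /inversion scalerA.
rewrite -/(inversion r p) sqnorm_inversion -[RHS]scale1r; congr (_ *: _).
by field; rewrite r0 p0.
Qed.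

Lemma inversion_neq0 r p : r != 0 -> p != 0 -> inversion r p != 0.
Proof.
rewrite -!sqnorm_eq0 sqnorm_inversion => r0 p0.
by rewrite mulf_neq0 ?invr_eq0 ?expf_neq0.
Qed.

Lemma continuous_inversion r p : p != 0 -> {for p, continuous (inversion r)}.
Proof.
rewrite -sqnorm_eq0 => p0; apply: continuousZ => //.
apply: continuousM; first exact: cst_continuous.
by apply: continuousV => //; exact: continuous_sqnorm.
Qed.

Definition exterior r : set sphere :=
  [set o | if o is Some p then r ^+ 2 <= sqnorm p else True].

(** The homeomorphism is the inversion, completed by exchanging 0 and infinity; [nbhs0_sqnormP] and
    [nbhs_inftyP] give continuity at these two points. *)
Lemma exterior_disc r :
  0 < r -> homeomorphic (@closed_unit_disc R) (exterior r).
Proof.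
move=> r0; have rN0 : r != 0 by rewrite gt_eqF.
pose h p : sphere := if p == 0 then None else Some (inversion r p).
pose g (o : sphere) := if o is Some p then inversion r p else 0.
have hK : cancel h g.
  by move=> p; rewrite /h; case: eqVneq => [->//|p0] /=; rewrite inversionK.
exists h, g; split.
- apply: continuous_subspaceT => p U.
  have [->|p0] := eqVneq p 0.
    rewrite /h eqxx => /nbhs_inftyP[UN [b bU]].
    (* The bound [b] may be negative or zero, hence the positive substitute. *)
    have b1 : 0 < `|b| + 1 by rewrite ltr_wpDl.
    apply/nbhs0_sqnormP; exists (r ^+ 2 / (`|b| + 1)).
      by rewrite divr_gt0 // exprn_gt0.
    move=> x xb /=; case: eqVneq => // x0; apply: bU.
    rewrite sqnorm_inversion ltr_pdivlMr ?sqnorm_gt0 //.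
    rewrite ltr_pdivlMr // in xb; have := ler_norm b.
    have := sqnorm_ge0 x; nra.
  rewrite {1}/h (negbTE p0) => /(continuous_inversion p0) pU.
  have {}pU : nbhs p [set x | U (Some (inversion r x))] by exact: pU.
  have p1 : 0 < sqnorm p by rewrite sqnorm_gt0.
  move: pU (nbhs_sqnorm_gt p1); apply: filterS2 => x /= xU.
  by rewrite sqnorm_gt0 /h => /negbTE ->.
- apply/subspace_continuousP => -[p|_].
    move=> rp; apply: cvg_within_filter => V.
    have p0 : p != 0.
      by rewrite -sqnorm_gt0 (lt_le_trans _ rp) // exprn_gt0.
    exact: continuous_inversion.
  apply: cvg_within_filter => V /nbhs0_sqnormP[e e0 eV].
  apply/nbhs_inftyP; split; first by apply: eV; rewrite sqnorm0.
  exists (r ^+ 2 / e) => p pe; apply: eV.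
  have p0 : 0 < sqnorm p by rewrite (lt_trans _ pe) // divr_gt0 // exprn_gt0.
  by rewrite sqnorm_inversion ltr_pdivrMr // mulrC -ltr_pdivrMr.
- apply/seteqP; split => [_ [p p1 <-]|[p rp|_]].
  + rewrite /h /exterior /=; case: eqVneq => //= p0.
    by rewrite sqnorm_inversion ler_pdivlMr ?sqnorm_gt0 // ler_piMr ?sqr_ge0.
  + have p0 : 0 < sqnorm p by rewrite (lt_le_trans _ rp) // exprn_gt0.
    exists (inversion r p).
      rewrite /closed_unit_disc /= -/(sqnorm _) sqnorm_inversion.
      by rewrite ler_pdivrMr // mul1r.
    rewrite sqnorm_gt0 in p0.
    by rewrite /h (negbTE (inversion_neq0 rN0 p0)) inversionK.
  + exists 0; last by rewrite /h eqxx.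
    by rewrite /closed_unit_disc /= -/(sqnorm _) sqnorm0 ler01.
- by move=> p _; exact: hK.
Qed.

(** By contraposition, the first condition puts the preimage of the exterior strictly outside the
    circle, hence in the interior. The second expels each finite point from some preimage; [n] is
    positive because the intersection starts at 1. *)
Lemma infty_repellor_exterior f r : 0 < r ->
  (forall p, sqnorm p <= r ^+ 2 -> sqnorm (f p) < r ^+ 2) ->
  (forall p, exists2 n, (0 < n)%N & sqnorm (iter n f p) < r ^+ 2) ->
  infty_repellor f.
Proof.
move=> r0 fr fn; exists (exterior r).
have iterN n : iter n (extend_infty f) None = None by elim: n => //= n ->.
have iterS n p : iter n (extend_infty f) (Some p) = Some (iter n f p).
  by elim: n => //= n ->.
split.
- exact: exterior_disc.
- by apply/nbhs_inftyP; split => //; exists (r ^+ 2) => p /ltW.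
- move=> [p|_] /=.
    rewrite /exterior /= => rfp.
    have rp : r ^+ 2 < sqnorm p.
      by rewrite ltNge; apply/negP => /fr; rewrite ltNge rfp.
    by apply: filterS (nbhs_sqnorm_gt rp) => x /= /ltW.
  by apply/nbhs_inftyP; split => //; exists (r ^+ 2) => p /ltW.
- apply/seteqP; split => [[p|//] pD|_ -> n _] /=; last by rewrite iterN.
  have [n n0] := fn p; rewrite ltNge => /negP[].
  by have := pD n n0; rewrite /= iterS.
Qed.

End Compactification.

(** * The damped rotation: inverse, spectrum, repulsion from infinity, period four *)

Section DampedRotation.
Context {R : realType}.
Implicit Types (a b t : R) (p : 'rV[R]_2).

Definition rV2 (T : nzRingType) (x y : T) : 'rV[T]_2 := \row_j [:: x; y]`_j.

Lemma mulmx_rV2 (T : nzRingType) n (v : 'rV[T]_2) (M : 'M[T]_(2, n)) j :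
  (v *m M) 0 j = v 0 0 * M 0 j + v 0 1 * M 1 j.
Proof.
rewrite mxE big_ord_recl big_ord1.
by congr (_ + fun_of_matrix v _ _ * fun_of_matrix M _ _); exact/val_inj.
Qed.

Definition damped_rotation b a p : 'rV[R]_2 :=
  rV2 (b * p 0 1) (a * sin (p 0 1) - b * p 0 0).

Definition rotation_mx b : 'M[R]_2 :=
  \matrix_i (if i == 0 then rV2 0 (- b) else rV2 b 0).

Lemma damped_rotationE b a :
  damped_rotation b a = sinusoid 0 (rotation_mx b) 1 1 (rV2 0 a) 0.
Proof.
apply/funext => p; rewrite /sinusoid add0r mul1r scaler0 addr0.
by apply: rV2_ext; rewrite mxE [RHS]mxE mulmx_rV2 !mxE /=; ring.
Qed.

Lemma smooth_diffeomorphism_damped_rotation b a :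
  b != 0 -> smooth_diffeomorphism (damped_rotation b a).
Proof.
move=> b0; split; first by rewrite damped_rotationE; exact: smooth_sinusoid.
(* Obtained by solving [X = b y], [Y = a sin y - b x] for [(x, y)]. *)
pose g p := rV2 ((a * sin (b^-1 * p 0 0) - p 0 1) / b) (p 0 0 / b).
exists g; split.
- rewrite (_ : g = sinusoid 0 (rotation_mx b^-1)^T b^-1 0 (rV2 (a / b) 0) 0).
    exact: smooth_sinusoid.
  apply/funext => p; rewrite /sinusoid add0r scaler0 addr0.
  by apply: rV2_ext; rewrite mxE [RHS]mxE mulmx_rV2 !mxE /=; ring.
- by move=> p; apply: rV2_ext; rewrite !mxE /= ?mulKf //; field.
- move=> p; apply: rV2_ext; rewrite !mxE /= ?(mulrC _ b^-1); by field.
Qed.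

Lemma Spec_damped_rotation b a : 0 < b < 1 -> `|a| < 1 + b ^+ 2 ->
  Spec (damped_rotation b a) `<=` @unit_disc R.
Proof.
move=> /andP[b0 b1] ab z [p /eigenvalueP[v vz v0]].
have JE i j : 'J (damped_rotation b a) p i j =
    rotation_mx b i j + (i == 1)%:R * cos (p 0 1) * rV2 0 a 0 j.
  rewrite damped_rotationE /jacobian mxE.
  have fP := is_diff_sinusoid 0 (rotation_mx b) 1 1 (rV2 0 a) 0 p.
  rewrite diff_val -rowE 2!mxE; congr (_ + _).
  by rewrite !mul1r scaler0 subr0 !mxE eqxx /= eq_sym mulrA.
have := congr1 (fun w : 'rV_2 => w 0 0) vz.
have := congr1 (fun w : 'rV_2 => w 0 1) vz.
rewrite /= !mulmx_rV2 ![map_mx _ _ _ _]mxE !JE !mxE /=.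
rewrite ?(mul0r, mulr0, add0r, mul1r, addr0, rmorph0) rmorphN => e1 e0.
have b0C : b%:C%C != 0 by rewrite fmorph_eq0 gt_eqF.
(* If [v 0 0] vanished, the first coordinate of the eigenvector equation would force [v 0 1 = 0]
   too. *)
have v00 : v 0 0 != 0.
  apply: contraNneq v0 => v00; move/eqP: e0.
  rewrite v00 mulr0 mulf_eq0 (negbTE b0C) orbF => /eqP v01.
  by apply/eqP/rV2_ext; rewrite mxE.
apply: (@schur_stable_quadratic _ (cos (p 0 1) * a) (b ^+ 2)).
- by rewrite exprn_gt0 ?exprn_ilt1 // ltW.
- by rewrite normrM (le_lt_trans _ ab) // ler_piMl // cos_max.
- apply: (mulIf v00); rewrite mul0r rmorphXn /=.
  (* This combination of the two coordinates of the eigenvector equation eliminates [v 0 1] and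
     leaves the characteristic polynomial times [v 0 0]. *)
  transitivity (b%:C%C * (z * v 0 1 - (cos (p 0 1) * a)%:C%C * v 0 1
    + b%:C%C * v 0 0) - (v 0 1 * b%:C%C - z * v 0 0)
      * (z - (cos (p 0 1) * a)%:C%C)); first by ring.
  by rewrite -e1 e0; ring.
Qed.

Lemma infty_repellor_damped_rotation b a :
  0 < b < 1 -> infty_repellor (damped_rotation b a).
Proof.
move=> /andP[b0 b1].
have b2 : 0 < 1 - b by rewrite subr_gt0.
(* The bound [s |-> b s + a^2 / (1 - b)] on square norms has fixed point [(a / (1 - b))^2]; the
   added 1 makes [r^2] strictly larger. *)
set f := damped_rotation b a; set r := `|a| / (1 - b) + 1.
have r0 : 0 < r by rewrite ltr_wpDl // divr_ge0 // ltW.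
(* AM-GM: [- 2 a b s x <= b (1 - b) x^2 + a^2 b s^2 / (1 - b)] *)
have fq p : (1 - b) * sqnorm (f p) <= (1 - b) * (b * sqnorm p) + a ^+ 2.
  rewrite /sqnorm !mxE /=; set s := sin _; set x := p 0 0; set y := p 0 1.
  have s1 : 0 <= 1 - s ^+ 2 by rewrite subr_ge0 -(cos2Dsin2 (p 0 1)) lerDr sqr_ge0.
  have := mulr_ge0 (sqr_ge0 a) s1.
  have := mulr_ge0 (ltW b0) (sqr_ge0 ((1 - b) * x + a * s)).
  have := mulr_ge0 (mulr_ge0 (ltW b0) (sqr_ge0 (1 - b))) (sqr_ge0 y).
  lra.
have rC : a ^+ 2 < (1 - b) ^+ 2 * r ^+ 2.
  rewrite -exprMn -real_normK ?num_real // ltr_pXn2r ?nnegrE //.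
  - by rewrite /r mulrDr mulrCA divff ?gt_eqF // !mulr1 ltrDl.
  - by rewrite mulr_ge0 ?ltW.
(* As long as the square norm is at least [r^2], each step lowers it by at least [d]. *)
pose d := (1 - b) * r ^+ 2 - a ^+ 2 / (1 - b).
have d0 : 0 < d by rewrite subr_gt0 ltr_pdivrMr // mulrAC -expr2.
have fd p : sqnorm (f p) <= b * sqnorm p + ((1 - b) * r ^+ 2 - d).
  rewrite /d subKr -(ler_pM2l b2) [leRHS]mulrDr [(1 - b) * (_ / _)]mulrCA.
  by rewrite divff ?gt_eqF // mulr1.
apply: (infty_repellor_exterior r0) => [p pr|p].
  have := fd p; nra.
(* An orbit staying outside would lose [d] forever and reach a negative square norm. The count
   starts at [f p], since nothing is assumed of [p] itself. *)
have [//|rn] := pselect (exists2 n, (0 < n)%N & sqnorm (iter n f p) < r ^+ 2).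
have rn' n : r ^+ 2 <= sqnorm (iter n.+1 f p).
  by rewrite leNgt; apply/negP => nr; apply: rn; exists n.+1.
have qn n : sqnorm (iter n.+1 f p) <= sqnorm (f p) - n%:R * d.
  elim: n => [|n IH]; first by rewrite mul0r subr0.
  have := fd (iter n.+1 f p); have := rn' n; rewrite iterS -natr1; nra.
have := qn (Num.bound (sqnorm (f p) / d)).
have := archi_boundP (divr_ge0 (sqnorm_ge0 (f p)) (ltW d0)).
rewrite ltr_pdivrMr // => h1 h2.
have := sqnorm_ge0 (iter (Num.bound (sqnorm (f p) / d)).+1 f p); lra.
Qed.

(** The second iterate negates the point, and the map is odd. The second coordinates
    [2t, -t, -2t, t] already show that no earlier return occurs. *)
Lemma periodic_damped_rotation b a t : t != 0 ->
  a * sin t = 2 * (1 - b ^+ 2) * t -> cos t = - 4^-1 ->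
  periodic_point 4 (damped_rotation b a) (rV2 (b * t) (2 * t)).
Proof.
move=> t0 ast ct; set f := damped_rotation b a.
have as2t : a * sin (2 * t) = - (1 - b ^+ 2) * t.
  rewrite (_ : 2 * t = t + t); last by ring.
  by rewrite sinD ct; lra.
have f1 x y : f (rV2 x y) = rV2 (b * y) (a * sin y - b * x).
  by rewrite /f /damped_rotation !mxE.
have it1 : f (rV2 (b * t) (2 * t)) = rV2 (b * (2 * t)) (- t).
  by rewrite f1 as2t; congr rV2; ring.
have it2 : f (rV2 (b * (2 * t)) (- t)) = rV2 (b * (- t)) (- (2 * t)).
  by rewrite f1 sinN (mulrN a) ast; congr rV2; ring.
have it3 : f (rV2 (b * (- t)) (- (2 * t))) = rV2 (b * (- (2 * t))) t.
  by rewrite f1 sinN (mulrN a) as2t; congr rV2; ring.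
have it4 : f (rV2 (b * (- (2 * t))) t) = rV2 (b * t) (2 * t).
  by rewrite f1 ast; congr rV2; ring.
have rV2_neq x y : y != 2 * t -> rV2 x y <> rV2 (b * t) (2 * t).
  by move=> /eqP y2t /(congr1 (fun v : 'rV_2 => v 0 1)); rewrite !mxE.
split => //; first by rewrite /= it1 it2 it3 it4.
case=> [|[|[|[|//]]]] // _; rewrite /= it1 ?it2 ?it3; apply: rV2_neq;
  apply: contra t0 => /eqP h; apply/eqP; lra.
Qed.
End DampedRotation.

Theorem theorem4p4 (R : realType) :
  exists f : 'rV[R]_2 -> 'rV[R]_2,
    [/\ smooth_diffeomorphism f,
        exists p, periodic_point 4 f p,
        infty_repellor f,
        f 0 = 0 &
        Spec f `<=` @unit_disc R].
Proof.
pose t : R := acos (- 4^-1); pose b : R := 9 / 10.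
have q1 : -1 <= - (4^-1 : R) <= 1 by apply/andP; split; lra.
have t0 : 0 < t by apply: acos_gt0; apply/andP; split; lra.
(* Crude bounds suffice: with [sin t > 9/10] they give [a = 0.38 t / sin t < 1.69], below
   [1 + b^2 = 1.81]. *)
have t4 : t < 4.
  by have := @acos_lepi R _ q1; have := @pihalf_lt2 R; rewrite -/t; lra.
have ct : cos t = - 4^-1 by rewrite acosK // in_itv.
(* Here [sin t] is the nonnegative root of [1 - 1/16 = 15/16], which exceeds [(9/10)^2]. *)
have st : 9 / 10 < sin t.
  have s0 : 0 <= sin t.
    by apply: sin_ge0_pi; rewrite (ltW t0) /= acos_lepi.
  have := cos2Dsin2 t; rewrite ct; nra.
pose a := 2 * (1 - b ^+ 2) * t / sin t.
have ast : a * sin t = 2 * (1 - b ^+ 2) * t.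
  by rewrite divfK //; apply: lt0r_neq0; lra.
have b01 : 0 < b < 1 by apply/andP; split; rewrite /b; lra.
exists (damped_rotation b a); split.
- by apply: smooth_diffeomorphism_damped_rotation; rewrite /b; lra.
- exists (rV2 (b * t) (2 * t)).
  by apply: periodic_damped_rotation => //; rewrite gt_eqF.
- exact: infty_repellor_damped_rotation.
- by apply: rV2_ext; rewrite !mxE /= ?sin0; ring.
- apply: Spec_damped_rotation => //.
  have a0 : 0 <= a by rewrite divr_ge0 //; rewrite /b; nra.
  by rewrite ger0_norm //; move: ast; rewrite /b; nra.
Qed.
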